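(* Let $d \ge 2$ be an integer, and let $1 < p < d$ and $1 < q < \frac{pd}{d-p}$. Then for every $q_1$ with $1 \le q_1 < q$ there exists a sequence $(u_n)_n$ of functions in $C^\infty_c(\mathbb{R}^d)$ such that, for all $n$, $$\int_{\mathbb{R}^d}|\nabla u_n|^p\,d\mathbf{x}\leq 1 \qquad\text{and}\qquad \sup_{\rho>0,\ \mathbf{z}\in\mathbb{R}^d}\rho^{\frac{d(q_1-q)}{q}}\int_{B_\rho(\mathbf{z})}|u_n|^{q_1}\,d\mathbf{x} \leq 1,$$ and moreover, for every $r>0$, $$\int_{\mathbb{R}^d}|u_n|^r\,d\mathbf{x} \;\sim\; 2^{\frac{d^2(q-q_1)}{q(dp-(d-p)q)}\left(p\left(1+\frac{q}{d}\right)-r\right)n} \qquad \text{for all } n\gg 1.$$ In particular, for $r>0$, there exists a constant $C>0$ independent of $n$ such that $$\int_{\mathbb{R}^d}|u_n|^r\,d\mathbf{x} \leq C \qquad \text{for all } n\gg 1$$ if and only if $r\geq p\left(\frac{q}{d}+1\right)$.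
   Context: $B_\rho(\mathbf{z}) = \{\mathbf{y}\in\mathbb{R}^d : |\mathbf{y}-\mathbf{z}|<\rho\}$ is the open ball. $C^\infty_c(\mathbb{R}^d)$ is the space of infinitely differentiable real-valued functions on $\mathbb{R}^d$ with compact support. For nonnegative quantities $a=a_n$, $b=b_n$, the notation $a\sim b$ means that there exist constants $C_1,C_2>0$, independent of $n$ (they may depend on the fixed parameters $d,p,q,q_1,r$), such that $C_1 a\le b\le C_2 a$. ''For all $n\gg 1$'' means for all $n\ge n_0$, for some $n_0$. *)

(* Defs.v *)
From HB Require Import structures.
From mathcomp Require Import all_boot all_order all_algebra.
From mathcomp Require Import all_classical all_reals all_analysis.

Set Implicit Arguments.
Unset Strict Implicit.
Unset Printing Implicit Defensive.
Import Order.TTheory GRing.Theory Num.Theory.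
Import numFieldNormedType.Exports.
Local Open Scope classical_set_scope.
Local Open Scope ring_scope.

(* The vectors of R^d are the row vectors 'rV[R]_d.  They carry the product of
   the Borel sigma-algebras of R (the one generated by the coordinates, as the
   library does for d.-tuple R), i.e. the Borel sigma-algebra of R^d. *)
Definition rV_display : measure_display.
Proof. exact: default_measure_display. Qed.

Section measurable_rV.
Context {R : realType} {d : nat}.

Definition rV_coord (i : 'I_d) (x : 'rV[R]_d) : R := x ord0 i.

Let rV_set0 : g_sigma_preimage rV_coord set0.
Proof. exact: sigma_algebra0. Qed.

Let rV_setC A : g_sigma_preimage rV_coord A -> g_sigma_preimage rV_coord (~` A).
Proof. exact: sigma_algebraC. Qed.

Let rV_bigcup (F : _^nat) : (forall i, g_sigma_preimage rV_coord (F i)) ->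
  g_sigma_preimage rV_coord (\bigcup_i (F i)).
Proof. exact: sigma_algebra_bigcup. Qed.

HB.instance Definition _ := @isMeasurable.Build rV_display
  'rV[R]_d (g_sigma_preimage rV_coord) rV_set0 rV_setC rV_bigcup.

End measurable_rV.

Lemma measurable_rV_coord (R : realType) d (i : 'I_d) :
  measurable_fun [set: 'rV[R]_d] (rV_coord i).
Proof.
move=> _ Y mY; rewrite setTI; apply: sub_sigma_algebra => /=.
rewrite -bigcup_seq/=; exists i => /=; first by rewrite mem_index_enum.
by exists Y => //; rewrite setTI.
Qed.

Lemma measurable_fun_rV d1 (T : measurableType d1) (R : realType) d
    (f : T -> 'rV[R]_d) :
  (forall i, measurable_fun [set: T] (rV_coord i \o f)) ->
  measurable_fun [set: T] f.
Proof.
move=> mf _ Y mY.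
suff : g_sigma_preimage (@rV_coord R d) `<=` [set A | measurable (setT `&` f @^-1` A)] by exact.
apply: smallest_sub => /=.
  split => /=.
  - by rewrite preimage_set0 setI0.
  - move=> A; rewrite !setTI setTD => mA; rewrite preimage_setC; exact: measurableC.
  - move=> F mF; rewrite setTI preimage_bigcup; apply: bigcupT_measurable => k.
    by have := mF k; rewrite setTI.
rewrite -bigcup_seq => A [i _] /= [B mB <-].
by rewrite setTI -comp_preimage; exact: mf.
Qed.

Section rV_cons.
Context {R : realType} {d : nat}.

Definition rV_cons (p : measurableTypeR R * 'rV[R]_d) : 'rV[R]_d.+1 :=
  row_mx (const_mx p.1 : 'rV_1) p.2.

Definition rV_uncons (x : 'rV[R]_d.+1) : measurableTypeR R * 'rV[R]_d :=
  (x ord0 ord0, \row_j x ord0 (lift ord0 j)).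

Lemma rV_cons0 p : rV_cons p ord0 ord0 = p.1.
Proof.
have -> : (ord0 : 'I_d.+1) = @lshift 1 d ord0 by exact: val_inj.
by rewrite (@row_mxEl R 1 1 d) mxE.
Qed.

Lemma rV_consS p j : rV_cons p ord0 (lift ord0 j) = p.2 ord0 j.
Proof.
have -> : lift ord0 j = @rshift 1 d j by exact: val_inj.
by rewrite (@row_mxEr R 1 1 d).
Qed.

Lemma rV_consK : cancel rV_cons rV_uncons.
Proof.
move=> [a v]; rewrite /rV_uncons rV_cons0; congr (_, _).
by apply/rowP => j; rewrite mxE rV_consS.
Qed.

Lemma measurable_rV_cons : measurable_fun [set: _] rV_cons.
Proof.
apply: measurable_fun_rV => i.
case: (unliftP ord0 i) => [j ->|->].
  rewrite (_ : _ \o _ = rV_coord j \o snd); last first.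
    by apply/funext => p /=; rewrite /rV_coord rV_consS.
  by apply: measurableT_comp => //; exact: measurable_rV_coord.
rewrite (_ : _ \o _ = fst); last first.
  by apply/funext => p /=; rewrite /rV_coord rV_cons0.
exact: measurable_fst.
Qed.

Lemma measurable_rV_uncons : measurable_fun [set: _] rV_uncons.
Proof.
apply: measurable_fun_pair => /=; first exact: measurable_rV_coord.
apply: measurable_fun_rV => i.
rewrite (_ : _ \o _ = rV_coord (lift ord0 i)); first exact: measurable_rV_coord.
by apply/funext => x; rewrite /rV_coord /= mxE.
Qed.

Variable mu : {sigma_finite_measure set 'rV[R]_d -> \bar R}.

Definition cons_measure : set 'rV[R]_d.+1 -> \bar R :=
  pushforward (@lebesgue_measure R \x mu)%E rV_cons.

Let cons_measure0 : cons_measure set0 = 0%E.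
Proof. by rewrite /cons_measure /pushforward preimage_set0 measure0. Qed.

Let measurable_preimage_rV_cons A : measurable A -> measurable (rV_cons @^-1` A).
Proof.
by move=> mA; rewrite -[X in measurable X]setTI; exact: measurable_rV_cons.
Qed.

Let cons_measure_ge0 A : (0 <= cons_measure A)%E.
Proof. by rewrite /cons_measure /pushforward; exact: measure_ge0. Qed.

Let cons_measure_sigma_additive : semi_sigma_additive cons_measure.
Proof.
move=> F mF tF mUF; rewrite /cons_measure /pushforward preimage_bigcup.
apply: measure_semi_sigma_additive.
- by move=> n; exact: measurable_preimage_rV_cons.
- apply/trivIsetP => /= i j _ _ ij; rewrite -preimage_setI.
  by move/trivIsetP : tF => /(_ _ _ _ _ ij) ->//; rewrite preimage_set0.
- by rewrite -preimage_bigcup; exact: measurable_preimage_rV_cons.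
Qed.

HB.instance Definition _ := isMeasure.Build _ _ _ cons_measure
  cons_measure0 cons_measure_ge0 cons_measure_sigma_additive.

Let cons_measure_sigma_finite : sigma_finite setT cons_measure.
Proof.
have /sigma_finiteP[F [TF ndF Foo]] := sigma_finiteT (@lebesgue_measure R).
have /sigma_finiteP[G [TG ndG Goo]] := sigma_finiteT mu.
exists (fun n => rV_uncons @^-1` (F n `*` G n)).
  rewrite -preimage_bigcup (_ : \bigcup_i _ = setT) ?preimage_setT//.
  apply/seteqP; split=> // -[a v] _.
  have [i _ Fia] : (\bigcup_i F i) a by rewrite -TF.
  have [j _ Gjv] : (\bigcup_i G i) v by rewrite -TG.
  exists (maxn i j) => //; split => /=.
    by move: a Fia; exact/subsetPset/ndF/leq_maxl.
  by move: v Gjv; exact/subsetPset/ndG/leq_maxr.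
move=> n; have [mF Fn] := Foo n; have [mG Gn] := Goo n; split.
  rewrite -[X in measurable X]setTI.
  by apply: measurable_rV_uncons => //; exact: measurableX.
rewrite /cons_measure /pushforward -comp_preimage.
rewrite (_ : _ \o _ = id) ?preimage_id; last exact/funext/rV_consK.
by rewrite product_measure1E// lte_mul_pinfty// ge0_fin_numE.
Qed.

HB.instance Definition _ := Measure_isSigmaFinite.Build _ _ _ cons_measure
  cons_measure_sigma_finite.

End rV_cons.

(* Lebesgue measure on R^d = R x R^(d-1), as an iterated product measure;
   lebesgue_rV_box below is its characteristic property. *)
Fixpoint lebesgue_rV {R : realType} {d : nat} :
    {sigma_finite_measure set 'rV[R]_d -> \bar R} :=
  match d with
  | 0 => \d_(0 : 'rV[R]_0)
  | d'.+1 => cons_measure (@lebesgue_rV R d')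
  end.

Lemma measurable_rV_box (R : realType) d (A : 'I_d -> set R) :
  (forall i, measurable (A i)) ->
  measurable [set x : 'rV[R]_d | forall i, A i (x ord0 i)].
Proof.
move=> mA.
rewrite (_ : mkset _ = \big[setI/setT]_(i < d) (rV_coord i @^-1` A i)).
  apply: bigsetI_measurable => i _; rewrite -[X in measurable X]setTI.
  exact: measurable_rV_coord.
apply/seteqP; split=> [x /= Ax|x].
  elim/big_ind: _ => [//|B C Bx Cx|i _]; first by split.
  exact: Ax.
by move=> + i /=; rewrite (bigD1 i)//= => -[].
Qed.

Lemma lebesgue_rV_box (R : realType) d (A : 'I_d -> set R) :
  (forall i, measurable (A i)) ->
  lebesgue_rV [set x : 'rV[R]_d | forall i, A i (x ord0 i)] =
  (\prod_(i < d) @lebesgue_measure R (A i))%E.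
Proof.
elim: d A => [|d IH] A mA /=.
  by rewrite big_ord0 diracE mem_set//= => -[].
rewrite big_ord_recl /cons_measure /pushforward.
rewrite (_ : _ @^-1` _ = A ord0 `*`
    [set x : 'rV[R]_d | forall i, A (lift ord0 i) (x ord0 i)]).
  have mB : measurable
      [set x : 'rV[R]_d | forall i, A (lift ord0 i) (x ord0 i)].
    by apply: (@measurable_rV_box R d (fun i => A (lift ord0 i))).
  rewrite product_measure1E; [|exact: mA|by []].
  congr (_ * _)%E; apply: (IH (fun i => A (lift ord0 i))) => i; exact: mA.
apply/seteqP; split=> [[a v] /= Ax|[a v] /= [Aa Av] i].
  split; first by have := Ax ord0; rewrite rV_cons0.
  by move=> i; have := Ax (lift ord0 i); rewrite rV_consS.
by case: (unliftP ord0 i) => [j ->|->]; rewrite (rV_consS, rV_cons0).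
Qed.

Section calculus.
Context {R : realType} {d : nat}.
Implicit Types (f : 'rV[R]_d -> R) (x z : 'rV[R]_d).

(* The norm `|x| provided by the library on 'rV[R]_d is the sup norm. *)
Definition enorm x : R := Num.sqrt (\sum_(i < d) x ord0 i ^+ 2).

Definition eball (rho : R) z : set 'rV[R]_d := [set y | enorm (y - z) < rho].

Definition partial (i : 'I_d) f : 'rV[R]_d -> R :=
  fun x => 'D_(delta_mx ord0 i) f x.

Definition gradient f x : 'rV[R]_d := \row_i partial i f x.

Fixpoint is_Ck (k : nat) f : Prop :=
  continuous f /\
  match k with
  | 0 => True
  | k'.+1 => forall i : 'I_d,
      (forall x, derivable f x (delta_mx ord0 i)) /\ is_Ck k' (partial i f)
  end.

Definition is_Cc_infty f : Prop :=
  (forall k, is_Ck k f) /\ compact (closure [set x | f x != 0]).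

End calculus.

(* a_n ~ b_n for all n >> 1. *)
Definition sim_near {R : realType} (a b : nat -> \bar R) : Prop :=
  exists C1 C2 : R, [/\ 0 < C1, 0 < C2 &
    \forall n \near \oo, (C1%:E * a n <= b n /\ b n <= C2%:E * a n)%E].

(* Main.v *)
Require Import Defs.
From mathcomp Require Import all_boot all_order all_algebra.
From mathcomp Require Import all_classical all_reals all_analysis.
From mathcomp Require Import measurable_realfun.
From mathcomp Require Import ring lra.

Import Order.TTheory GRing.Theory Num.Theory.
Import numFieldNormedType.Exports.
Local Open Scope classical_set_scope.
Local Open Scope ring_scope.

(** Fix a smooth bump supported in [-1, 1]^d and consider N translates of it,
    stretched to width s, multiplied by a height A and placed so far apart that
    they do not interact.  Up to constants,
      the L^p norm of the gradient to the power p is  N A^p s^(d - p),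
      the integral of |u|^r is                        N A^r s^d,
      a single bump has Morrey quotient               (A s^(d/q))^q1.
    The choice A = s^(-d/q) makes one bump critical for the Morrey condition, and
    the gradient bound then allows N = s^(gap/q) bumps, where
    gap = d p - (d - p) q is positive exactly because q < p d / (d - p).  Hence
    N -> oo as s -> oo, and the integral of |u|^r becomes
    s^((d/q) (p (1 + q/d) - r)), whose exponent changes sign at
    r = p (1 + q/d).  Taking s = 2^(d (q - q1) n / gap) gives the stated rate
    (gradient_scale and powR_height_mass).

    The Morrey condition for the whole train of bumps only depends on the
    spacing.  A ball of radius rho <= s is estimated by the sup norm; a ball
    meeting a single bump by the critical scaling of that bump; and a ball which
    can meet several bumps has, by the choice of the spacing, a radius of at least
    2^n s, so that its prefactor rho^(d (q1 - q) / q) already compensates for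
    all the N <= 2^(d (q - q1) n / q) bumps at once (lemmas morrey_small and
    morrey_large).

    The bumps are lined up along the first axis.  The function is then still a
    product of functions of one variable (tensor), its partial derivatives have
    the same form, and both the support and the set where the function is
    comparable to A are product sets, so that all integrals are estimated by
    constants times measures of boxes; no integral has to be computed.
    Smoothness comes from an explicit algebra of functions of one variable that
    is closed under differentiation (flat_algebra_derive, is_Ck_tensor). *)

(** * Smooth bumps on the line *)

(** The functions x^(-n) e^(-1/x), extended by 0: differentiation only changes the
    power n, so these generate an algebra closed under differentiation that
    contains a bump. *)
Definition flat {R : realType} (n : nat) (x : R) : R :=
  if 0 < x then expR (- x^-1) / x ^+ n else 0.

Lemma flat_ge0 {R : realType} n (x : R) : 0 <= flat n x.
Proof.
by rewrite /flat; case: ifPn => // x0; rewrite divr_ge0 ?expR_ge0 ?exprn_ge0 ?ltW.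
Qed.

Lemma flat_eq0 {R : realType} n (x : R) : x <= 0 -> flat n x = 0.
Proof. by rewrite /flat leNgt => /negPf ->. Qed.

(** With y = 1/x this is y^n <= n^n e^y, which holds because
    e^y = (e^(y/n))^n >= (1 + y/n)^n. *)
Lemma flat_le {R : realType} n (x : R) : flat n x <= n%:R ^+ n.
Proof.
rewrite /flat; case: ifPn => x0; last by rewrite exprn_ge0.
(* For n = 0 the bound is 0 ^+ 0 = 1. *)
case: n => [|n].
  by rewrite expr0 divr1 expr0 -expR0 ler_expR oppr_le0 invr_ge0 ltW.
have -> : - x^-1 = n.+1%:R * - (n.+1%:R * x)^-1.
  by rewrite invfM mulrN mulrA divff ?mul1r// pnatr_eq0.
rewrite expRM_natl -expr_div_n lerXn2r ?nnegrE ?divr_ge0 ?expR_ge0 ?ltW//.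
rewrite expRN -invfM invf_plt ?posrE ?mulr_gt0 ?expR_gt0//.
have n0 : 0 < n.+1%:R :> R by rewrite ltr0n.
rewrite -ltr_pdivrMr// -invfM mulrC (lt_le_trans _ (expR_ge1Dx _))//.
by rewrite ltrDr.
Qed.

(** One factor x may be traded for one in the exponent.  As [flat n.+1] is bounded,
    this gives the decay at 0 behind all the differentiability there. *)
Lemma flatS {R : realType} n (x : R) : flat n x = x * flat n.+1 x.
Proof.
rewrite /flat; case: ifPn => x0; last by rewrite mulr0.
by rewrite exprS invfM; field; rewrite ?gt_eqF ?exprn_gt0.
Qed.

(** At 0 the difference quotient of [flat n] is [flat n.+1] itself, which is
    [x * flat n.+2 x] and therefore tends to 0. *)
Lemma is_derive_flat {R : realType} n (x : R) :
  is_derive x 1 (flat n) (- n%:R * flat n.+1 x + flat n.+2 x).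
Proof.
have [x0|x0|->] := ltgtP x 0.
- rewrite !flat_eq0 ?ltW// mulr0 addr0.
  apply: near_eq_is_derive (is_derive_cst (0 : R) x 1).
  by near=> y; rewrite flat_eq0// ltW//; near: y; exact: lt_nbhsl.
- pose V y : R := y^-1.
  have x_0 : x != 0 by rewrite gt_eqF.
  have dV : is_derive x 1 V _ := @is_deriveV _ id x 1 1 x_0 (is_derive_id _ _).
  have dE := is_derive1_comp (is_derive_expR _) (is_deriveN dV).
  suff dF : is_derive x 1 ((expR \o - V) * V ^+ n)
      (- n%:R * flat n.+1 x + flat n.+2 x).
    apply: near_eq_is_derive dF.
    near=> y; rewrite /flat ifT; last by near: y; exact: lt_nbhsr.
    by rewrite -exprVn exprfctE.
  have dF := is_deriveM dE (is_deriveX n dV).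
  apply: is_derive_eq.
  rewrite /flat x0 /V /= fctE exprfctE -!exprVn.
  rewrite /GRing.scale /= mulr1 -/(V x); set v := V x.
  by case: n {dF} => [|m]; rewrite ?expr0 /= !exprS; ring.
- rewrite !flat_eq0// mulr0 addr0; apply/is_derive1_caratheodory.
  exists (flat n.+1); split; last by rewrite flat_eq0.
    by move=> z; rewrite subr0 [flat n 0]flat_eq0// subr0 mulrC -flatS.
  pose C : R := n.+2%:R ^+ n.+2.
  have C0 : 0 < C by rewrite exprn_gt0.
  apply/cvgrPdist_le => e e0; near=> z.
  rewrite [flat n.+1 0]flat_eq0// sub0r normrN flatS normrM (ger0_norm (flat_ge0 _ _)).
  rewrite (le_trans (ler_wpM2l _ (flat_le _ _)))//.
  rewrite -ler_pdivlMr//.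
  near: z; apply/nbhs_ballP; exists (e / C); first by rewrite /= divr_gt0.
  by move=> y; rewrite /ball /= sub0r normrN => /ltW.
Unshelve. all: by end_near. Qed.

(** The atoms carry an affine change of variable, so that translates and dilates
    of a bump stay in the class; since the class is closed under derivation,
    infinite differentiability of its members needs no Leibniz formula of higher
    order. *)
Inductive flat_algebra {R : realType} : (R -> R) -> Prop :=
| flat_algebra_atom n a c : flat_algebra (fun x => flat n (a * x + c))
| flat_algebra_cst c : flat_algebra (fun=> c)
| flat_algebra_add f g :
    flat_algebra f -> flat_algebra g -> flat_algebra (fun x => f x + g x)
| flat_algebra_mul f g :
    flat_algebra f -> flat_algebra g -> flat_algebra (fun x => f x * g x).

Lemma flat_algebra_derive {R : realType} (f : R -> R) : flat_algebra f ->
  exists2 f' : R -> R, flat_algebra f' & forall x : R, is_derive x 1 f (f' x).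
Proof.
elim=> {f} [n a c|c|f g _ [f' ff' df] _ [g' gg' dg]|
            f g ff [f' ff' df] gg [g' gg' dg]].
- exists (fun x => (- n%:R * flat n.+1 (a * x + c) + flat n.+2 (a * x + c)) * a).
    by do ![exact: flat_algebra_atom | exact: flat_algebra_cst
           | apply: flat_algebra_add | apply: flat_algebra_mul].
  move=> x.
  have dl : is_derive x 1 (fun x => a * x + c) a.
    by apply: is_derive_eq; rewrite addr0 /GRing.scale /= mulr1.
  exact: is_derive1_comp (is_derive_flat n _) dl.
- by exists (fun=> 0) => [|x]; [exact: flat_algebra_cst|exact: is_derive_cst].
- exists (fun x => f' x + g' x) => [|x]; first exact: flat_algebra_add.
  exact: is_deriveD.
- exists (fun x => f x * g' x + g x * f' x) => [|x].
    by apply: flat_algebra_add; exact: flat_algebra_mul.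
  exact: is_deriveM.
Qed.

Lemma flat_algebra_continuous {R : realType} (f : R -> R) :
  flat_algebra f -> continuous f.
Proof.
move=> /flat_algebra_derive[f' _ df] x.
by apply/differentiable_continuous/derivable1_diffP; case: (df x).
Qed.

Lemma flat_algebra_sum {R : realType} n (f : nat -> R -> R) :
  (forall k, flat_algebra (f k)) -> flat_algebra (fun x => \sum_(k < n) f k x).
Proof.
move=> ff; elim: n => [|n IH].
  rewrite (_ : (fun x => _) = fun=> 0); first exact: flat_algebra_cst.
  by apply/funext => x; rewrite big_ord0.
rewrite (_ : (fun x => _) = fun x => \sum_(k < n) f k x + f n x).
  exact: (flat_algebra_add _ _ IH (ff n)).
by apply/funext => x; rewrite big_ord_recr.
Qed.

Definition bump {R : realType} (x : R) : R := flat 0 (1 + x) * flat 0 (1 - x).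

Definition bump' {R : realType} (x : R) : R :=
  flat 2 (1 + x) * flat 0 (1 - x) - flat 0 (1 + x) * flat 2 (1 - x).

Lemma is_derive_bump {R : realType} (x : R) : is_derive x 1 bump (bump' x).
Proof.
have dp : is_derive x 1 (fun x : R => 1 + x) 1.
  by apply: is_derive_eq; rewrite add0r mul1r.
have dm : is_derive x 1 (fun x : R => 1 - x) (- 1).
  by apply: is_derive_eq; rewrite add0r mul1r.
have dfp := is_derive1_comp (is_derive_flat 0 _) dp.
have dfm := is_derive1_comp (is_derive_flat 0 _) dm.
apply: is_derive_eq (is_deriveM dfp dfm) _.
by rewrite /bump' /= oppr0 !mul0r !add0r /GRing.scale /=; ring.
Qed.

Lemma bump_ge0 {R : realType} (x : R) : 0 <= bump x.
Proof. by rewrite mulr_ge0 ?flat_ge0. Qed.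

Lemma bump_le1 {R : realType} (x : R) : bump x <= 1.
Proof.
have f1 (y : R) : flat 0 y <= 1 by rewrite (le_trans (flat_le _ _)) ?expr0.
by rewrite mulr_ile1 ?flat_ge0.
Qed.

Lemma bump_supp {R : realType} (x : R) : 1 <= `|x| -> bump x = 0 /\ bump' x = 0.
Proof.
rewrite /bump /bump'; case: (lerP 0 x) => x0; [rewrite ger0_norm// | rewrite ltr0_norm//].
  by move=> x1; rewrite ![flat _ (1 - x)]flat_eq0 ?subr_le0// !mulr0 subrr.
by move=> x1; rewrite ![flat _ (1 + x)]flat_eq0 ?mul0r ?subrr//; lra.
Qed.

Lemma bump'_le {R : realType} (x : R) : `|bump' x| <= 8.
Proof.
have f0 (y : R) : flat 0 y <= 1 by rewrite (le_trans (flat_le _ _)) ?expr0.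
have f2 (y : R) : flat 2 y <= 4 by rewrite (le_trans (flat_le _ _))// expr2 -natrM.
have b (y z : R) : `|flat 2 y * flat 0 z| <= 4.
  by rewrite ger0_norm ?mulr_ge0 ?flat_ge0// -[leRHS]mulr1 ler_pM ?flat_ge0.
rewrite (le_trans (ler_normB _ _))// [X in _ + `|X|]mulrC.
by rewrite (le_trans (lerD (b _ _) (b _ _)))//; lra.
Qed.

(** Each factor is at least e^(-2) because its argument is at least 1/2. *)
Lemma expR_le_bump {R : realType} (x : R) : `|x| <= 2^-1 -> expR (-4) <= bump x.
Proof.
rewrite ler_norml => /andP[xl xr].
have f2 (y : R) : 2^-1 <= y -> expR (-2) <= flat 0 y.
  move=> y2; have y0 : 0 < y by lra.
  by rewrite /flat y0 expr0 divr1 ler_expR lerN2 invf_ple ?posrE.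
have -> : -4 = -2 + -2 :> R by lra.
by rewrite expRD ler_pM ?expR_ge0 ?f2//; lra.
Qed.

(** * Products of functions of one variable, and trains of bumps *)

Definition tensor {R : realType} {d : nat} (c : R) (g : 'I_d -> R -> R)
    (x : 'rV[R]_d) : R :=
  c * \prod_(i < d) g i (x ord0 i).

Lemma tensor_continuous {R : realType} {d : nat} (c : R) (g : 'I_d -> R -> R) :
  (forall i, continuous (g i)) -> continuous (tensor c g).
Proof.
move=> gc.
suff H : continuous (fun y : 'rV[R]_d => \prod_(i < d) g i (y ord0 i)).
  by move=> x; exact: (cvgM (cvg_cst c) (H x)).
apply: continuous_big => [z|i _ x]; first exact: (cvgM cvg_fst cvg_snd).
apply: (@continuous_comp _ _ _ (fun y : 'rV[R]_d => y ord0 i) (g i)).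
  exact: coord_continuous.
exact: gc.
Qed.

(** Along the i-th axis all the factors but the i-th are constant. *)
Lemma is_derive_tensor {R : realType} {d : nat} (c : R) (g : 'I_d -> R -> R)
    (i : 'I_d) (g' : R -> R) (x : 'rV[R]_d) :
  is_derive (x ord0 i) 1 (g i) (g' (x ord0 i)) ->
  is_derive x (delta_mx ord0 i) (tensor c g)
    (tensor c (fun j => if j == i then g' else g j) x).
Proof.
move=> dg; pose K := c * \prod_(j < d | j != i) g j (x ord0 j).
have tK (f : R -> R) (y : 'rV[R]_d) : (forall j, j != i -> y ord0 j = x ord0 j) ->
    tensor c (fun j => if j == i then f else g j) y = K * f (y ord0 i).
  move=> yx; rewrite /tensor /K (bigD1 i)//= eqxx mulrCA mulrC.
  by congr (_ * _ * _); apply: eq_bigr => j ji; rewrite (negPf ji) yx.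
have gE : (fun j => if j == i then g i else g j) = g.
  by apply/funext => j; case: eqP => // ->.
rewrite tK//.
suff H : h^-1 *: ((tensor c g \o shift x) (h *: delta_mx ord0 i) - tensor c g x)
    @[h --> 0^'] --> K * g' (x ord0 i).
  by apply: DeriveDef; [apply/cvg_ex; exists (K * g' (x ord0 i))|exact: cvg_lim].
have -> : (fun h => h^-1 *: ((tensor c g \o shift x) (h *: delta_mx ord0 i) -
      tensor c g x)) =
    (fun h => K * (h^-1 *: ((g i \o shift (x ord0 i)) (h *: 1) - g i (x ord0 i)))).
  apply/funext => h; rewrite -gE /= !tK//.
    by rewrite !mxE eqxx /GRing.scale /=; case: eqP => // _; ring.
  by move=> j ji; rewrite !mxE (negPf ji) mulr0 add0r.
case: dg => dg <-.
exact: (cvgM (cvg_cst K) dg).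
Qed.

(** A partial derivative is again a tensor of members of the algebra, hence an
    induction on the order. *)
Lemma is_Ck_tensor {R : realType} {d : nat} (k : nat) (c : R) (g : 'I_d -> R -> R) :
  (forall i, flat_algebra (g i)) -> is_Ck k (tensor c g).
Proof.
elim: k g => [|k IH] g gf.
  by split=> //; apply: tensor_continuous => i; exact: flat_algebra_continuous.
split; first by apply: tensor_continuous => i; exact: flat_algebra_continuous.
move=> i; have [g' g'f dg] := flat_algebra_derive _ (gf i).
split=> [x|]; first by case: (is_derive_tensor c g i g' x (dg _)).
rewrite (_ : partial i (tensor c g) =
    tensor c (fun j => if j == i then g' else g j)).
  by apply: IH => j; case: ifP.
by apply/funext => x; case: (is_derive_tensor c g i g' x (dg _)).
Qed.

Definition train {R : realType} (f : R -> R) (N : nat) (L s t : R) : R :=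
  \sum_(k < N) f ((t - k%:R * L) / s).

Definition slots {R : realType} (N : nat) (L h : R) : set R :=
  [set t | exists2 k, (k < N)%N & `|t - k%:R * L| <= h].

Lemma slot_inj {R : realType} (L h t : R) (j k : nat) : 2 * h < L ->
  `|t - j%:R * L| <= h -> `|t - k%:R * L| <= h -> j = k.
Proof.
move=> hL.
rewrite !ler_norml => tj tk.
wlog jk : j k tj tk / (j < k)%N.
  by move=> W; case: (ltngtP j k) => // ?; [|symmetry]; exact: W.
have le_jk : j%:R * L + L <= k%:R * L.
  by rewrite -[X in _ + X]mul1r -mulrDl natr1 ler_wpM2r ?ler_nat//; clear jk; lra.
by exfalso; move: tj tk; clear jk; lra.
Qed.

Section train.
Context {R : realType}.
Variables (f : R -> R) (N : nat) (L s : R).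
Hypotheses (f_supp : forall x, 1 <= `|x| -> f x = 0) (s0 : 0 < s) (sL : 2 * s < L).

Let train_term (t : R) (k : nat) : s <= `|t - k%:R * L| -> f ((t - k%:R * L) / s) = 0.
Proof.
by move=> tk; rewrite f_supp// normrM normfV (gtr0_norm s0) ler_pdivlMr// mul1r.
Qed.

(** At most one term of the train is active at a given point, so bounds on f
    transfer to the train with the same constants, whatever N is. *)
Lemma train_in (t : R) (k : nat) : (k < N)%N -> `|t - k%:R * L| <= s ->
  train f N L s t = f ((t - k%:R * L) / s).
Proof.
move=> kN tk; rewrite /train (bigD1 (Ordinal kN))//= big1 ?addr0// => j jk.
apply: train_term; rewrite leNgt; apply: contra jk => /ltW tj.
by apply/eqP/val_inj; exact: slot_inj tj tk.
Qed.

Lemma train_out (t : R) : ~ slots N L s t -> train f N L s t = 0.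
Proof.
move=> tN; rewrite /train big1// => k _; apply: train_term.
rewrite leNgt; apply/negP => /ltW tk; apply: tN.
by exists k.
Qed.

(** Stated for an arbitrary property so that it serves for upper bounds of the
    bump and for absolute bounds of its derivative alike. *)
Lemma train_range (P : R -> Prop) (t : R) : P 0 -> (forall x, P (f x)) ->
  P (train f N L s t).
Proof.
move=> P0 Pf; have [[k kN tk]|/train_out ->//] := pselect (slots N L s t).
by rewrite (train_in _ _ kN tk).
Qed.

End train.

Lemma slotsE {R : realType} (N : nat) (L h : R) : slots N L h =
  \big[setU/set0]_(k < N) [set` `[k%:R * L - h, k%:R * L + h]].
Proof.
rewrite -(bigcup_mkord N (fun k => [set` `[k%:R * L - h, k%:R * L + h]])).
apply/seteqP; split=> t [k kN]; rewrite ?ler_distl.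
  by move=> tk; exists k => //=; rewrite in_itv /=; lra.
by rewrite /= in_itv /= => tk; exists k => //; rewrite ler_norml; lra.
Qed.

Lemma measurable_slots {R : realType} (N : nat) (L h : R) :
  measurable (slots N L h : set (measurableTypeR R)).
Proof. by rewrite slotsE; apply: bigsetU_measurable => k _; exact: measurable_itv. Qed.

Lemma lebesgue_slots {R : realType} (N : nat) (L h : R) : 0 < h -> 2 * h < L ->
  lebesgue_measure (slots N L h) = (N%:R * (2 * h))%:E.
Proof.
move=> h0 hL; rewrite slotsE measure_bigsetU_ord.
- rewrite (eq_bigr (fun=> (2 * h)%:E)) => [|k _]; last first.
    rewrite /= lebesgue_measure_itv /= lte_fin ltrD2l gtrN// -EFinD.
    by congr EFin; ring.
  by rewrite sumEFin sumr_const card_ord -(mulr_natl (2 * h) N).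
- by move=> k; exact: measurable_itv.
- apply/trivIsetP => /= j k _ _ jk; apply/seteqP; split=> // t /=.
  rewrite !in_itv /= => -[tj tk]; move/eqP : jk; apply; apply: val_inj.
  by apply: (slot_inj _ _ t _ _ hL); rewrite ler_norml; lra.
Qed.

Lemma flat_algebra_affine {R : realType} (f : R -> R) (a c : R) :
  flat_algebra f -> flat_algebra (fun x => f (a * x + c)).
Proof.
elim=> {f} [n b e|e|f g _ IHf _ IHg|f g _ IHf _ IHg].
- rewrite (_ : (fun x => _) = fun x => flat n ((b * a) * x + (b * c + e))).
    exact: flat_algebra_atom.
  by apply/funext => x; congr flat; ring.
- exact: flat_algebra_cst.
- exact: flat_algebra_add IHf IHg.
- exact: flat_algebra_mul IHf IHg.
Qed.

Lemma flat_algebra_bump {R : realType} : flat_algebra (@bump R).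
Proof.
have -> : @bump R = fun x => flat 0 (1 * x + 1) * flat 0 (-1 * x + 1).
  by apply/funext => x; rewrite /bump mul1r mulN1r ![_ + 1]addrC.
by apply: flat_algebra_mul; exact: flat_algebra_atom.
Qed.

Lemma flat_algebra_train {R : realType} (N : nat) (L s : R) :
  flat_algebra (train bump N L s).
Proof.
apply: (flat_algebra_sum _ (fun k t => bump ((t - k%:R * L) / s))) => k.
rewrite (_ : (fun t => _) = fun t => bump (s^-1 * t + - (k%:R * L / s))).
  exact: flat_algebra_affine flat_algebra_bump.
by apply/funext => t; congr bump; ring.
Qed.

Lemma is_derive_train {R : realType} (N : nat) (L s t : R) :
  is_derive t 1 (train bump N L s) (train bump' N L s t / s).
Proof.
rewrite /train mulr_suml.
rewrite (_ : (fun t => _) = \sum_(k < N) (fun t => bump ((t - k%:R * L) / s))).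
  apply: is_derive_sum => k.
  have dl : is_derive t 1 (fun t => (t - k%:R * L) / s) s^-1.
    by apply: is_derive_eq; rewrite scaler0 add0r subr0 /GRing.scale /= mulr1.
  exact: is_derive1_comp (is_derive_bump _) dl.
by apply/funext => x; rewrite fct_sumE.
Qed.

(** * Integral bounds and Euclidean norms *)

Section integral_bounds.
Local Open Scope ereal_scope.
Context {dT : measure_display} {T : measurableType dT} {R : realType}.
Variables (mu : {measure set T -> \bar R}) (f : T -> R) (c : R).
Hypotheses (mf : measurable_fun [set: T] f) (f0 : forall x, (0 <= f x)%R).

(** The intersection with E is kept in the bound: for the Morrey condition, D is
    a ball and E the support, and at intermediate radii neither alone is small
    enough. *)
Lemma integral_le_cst (D E : set T) : measurable D -> measurable E ->
  (0 <= c)%R -> (forall x, D x -> (f x <= c)%R) ->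
  (forall x, D x -> ~ E x -> f x = 0%R) ->
  \int[mu]_(x in D) (f x)%:E <= c%:E * mu (D `&` E).
Proof.
move=> mD mE c0 fc fE; have mDE := measurableI _ _ mD mE.
have -> : \int[mu]_(x in D) (f x)%:E = \int[mu]_(x in D `&` E) (f x)%:E.
  rewrite integral_mkcondr; apply: eq_integral => x /set_mem Dx.
  by rewrite patchE; case: ifPn => // /negP xE; rewrite fE// => Ex; exact/xE/mem_set.
rewrite -integral_cst//; apply: ge0_le_integral => //.
- by move=> x _; rewrite lee_fin.
- by apply/measurable_EFinP; exact: measurable_funS mf.
- by move=> x [Dx _]; rewrite lee_fin fc.
Qed.

Lemma integral_ge_cst (E : set T) : measurable E ->
  (0 <= c)%R -> (forall x, E x -> (c <= f x)%R) ->
  c%:E * mu E <= \int[mu]_x (f x)%:E.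
Proof.
move=> mE c0 fc; rewrite -integral_cst//.
apply: (@le_trans _ _ (\int[mu]_(x in E) (f x)%:E)).
  apply: ge0_le_integral => //.
  by apply/measurable_EFinP; exact: measurable_funS mf.
apply: ge0_subset_integral => //.
- exact/measurable_EFinP.
- by move=> x _; rewrite lee_fin.
Qed.

End integral_bounds.

Section euclidean.
Context {R : realType} {d : nat}.
Implicit Types x z : 'rV[R]_d.

Lemma enorm_ge_coord x (i : 'I_d) : `|x ord0 i| <= enorm x.
Proof.
rewrite -sqrtr_sqr ler_sqrt; last by rewrite sumr_ge0// => j _; exact: sqr_ge0.
by rewrite (bigD1 i)//= lerDl sumr_ge0// => j _; exact: sqr_ge0.
Qed.

Lemma enorm_le x (c : R) : (forall i, `|x ord0 i| <= c) -> enorm x <= d%:R * c.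
Proof.
move=> xc; case: d x xc => [|n] x xc.
  by rewrite /enorm big_ord0 sqrtr0 mul0r.
have c0 : 0 <= c := le_trans (normr_ge0 _) (xc ord0).
rewrite -[leRHS]ger0_norm ?mulr_ge0// -sqrtr_sqr ler_sqrt ?sqr_ge0//.
apply: (@le_trans _ _ (\sum_(i < n.+1) c ^+ 2)).
  by apply: ler_sum => i _; rewrite -real_normK ?num_real// lerXn2r ?nnegrE.
rewrite sumr_const card_ord -[leLHS]mulr_natl exprMn ler_wpM2r ?sqr_ge0//.
by rewrite expr2 ler_peMl// ler1n.
Qed.

Lemma measurable_tensor (c : R) (g : 'I_d -> R -> R) :
  (forall i, measurable_fun [set: R] (g i)) ->
  measurable_fun [set: 'rV[R]_d] (tensor c g).
Proof.
move=> mg; apply: measurable_funM; first exact: measurable_cst.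
apply: measurable_prod => i _.
apply: (measurableT_comp (mg i)); exact: measurable_rV_coord.
Qed.

Lemma measurable_enorm {dT} {T : measurableType dT} (f : T -> 'rV[R]_d) :
  (forall i, measurable_fun [set: T] (fun t => f t ord0 i)) ->
  measurable_fun [set: T] (fun t => enorm (f t)).
Proof.
move=> mf; apply: (measurableT_comp (f := @Num.sqrt R)).
  by apply: continuous_measurable_fun; exact: sqrt_continuous.
by apply: measurable_sum => i; apply: measurable_funX; exact: mf.
Qed.

Lemma measurable_eball (rho : R) z : measurable (eball rho z).
Proof.
have mz : measurable_fun [set: 'rV[R]_d] (fun y => enorm (y - z)).
  apply: measurable_enorm => i; under eq_fun do rewrite !mxE.
  by apply: measurable_funB => //; exact: measurable_rV_coord.
rewrite -[eball _ _]setTI (_ : eball _ _ = (fun y => enorm (y - z)) @^-1` `]-oo, rho[).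
  by apply: mz => //; exact: measurable_itv.
by apply/seteqP; split => y; rewrite /eball /= in_itv.
Qed.

Lemma tensor_supp (c : R) (g : 'I_d -> R -> R) x (i : 'I_d) :
  g i (x ord0 i) = 0 -> tensor c g x = 0.
Proof. by move=> gi; rewrite /tensor (bigD1 i)//= gi mul0r mulr0. Qed.

Lemma tensor_le (c : R) (w : 'I_d -> R) (g : 'I_d -> R -> R) x : 0 <= c ->
  (forall i, `|g i (x ord0 i)| <= w i) -> `|tensor c g x| <= c * \prod_i w i.
Proof.
move=> c0 gw; rewrite normrM ger0_norm// ler_wpM2l// normr_prod.
by apply: ler_prod => i _; rewrite normr_ge0 gw.
Qed.

Lemma tensor_ge (c w : R) (g : 'I_d -> R -> R) x : 0 <= c -> 0 <= w ->
  (forall i, w <= g i (x ord0 i)) -> c * w ^+ d <= tensor c g x.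
Proof.
move=> c0 w0 gw; rewrite ler_wpM2l//.
rewrite -[in leLHS](card_ord d) -prodr_const.
by apply: ler_prod => i _; rewrite w0 gw.
Qed.

End euclidean.

(** * Packets: trains of bumps in d dimensions *)

(** Repeating the bump along the first axis only keeps the superposition of N
    bumps of R^d a product of functions of one variable. *)
Definition pulses {d : nat} (N : nat) (i : 'I_d) : nat :=
  if i == 0%N :> nat then N else 1%N.

Definition packet {R : realType} {d : nat} (A s L : R) (N : nat) : 'rV[R]_d -> R :=
  tensor A (fun i => train bump (pulses N i) L s).

Definition packet_box {R : realType} {d : nat} (N : nat) (L h : R) : set 'rV[R]_d :=
  [set x | forall i, slots (pulses N i) L h (x ord0 i)].

Section packet.
Context {R : realType} {d : nat}.
Variables (A s L : R) (N : nat).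
Hypotheses (d0 : (0 < d)%N) (A0 : 0 < A) (s0 : 0 < s) (sL : 2 * s < L).
Local Notation u := (@packet R d A s L N).

Let bump0 (x : R) : 1 <= `|x| -> bump x = 0.
Proof. by case/bump_supp. Qed.

Let bump'0 (x : R) : 1 <= `|x| -> bump' x = 0.
Proof. by case/bump_supp. Qed.

Lemma prod_pulses : \prod_(i < d) (pulses N i)%:R = N%:R :> R.
Proof.
by case: d d0 => // n _; rewrite big_ord_recl /= big1 ?mulr1//.
Qed.

Lemma measurable_packet_box (h : R) : measurable (@packet_box R d N L h).
Proof.
apply: (@measurable_rV_box R d (fun i => slots (pulses N i) L h)) => i.
exact: measurable_slots.
Qed.

Lemma lebesgue_packet_box (h : R) : 0 < h -> 2 * h < L ->
  lebesgue_rV (@packet_box R d N L h) = (N%:R * (2 * h) ^+ d)%:E.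
Proof.
move=> h0 hL.
rewrite (@lebesgue_rV_box R d (fun i => slots (pulses N i) L h)) => [|i];
  last exact: measurable_slots.
under eq_bigr do rewrite lebesgue_slots//.
by rewrite prodEFin big_split /= prod_pulses prodr_const card_ord.
Qed.

Lemma train_bump_ge0 M t : 0 <= train bump M L s t.
Proof. by apply: sumr_ge0 => k _; exact: bump_ge0. Qed.

Lemma train_bump_le1 M t : `|train bump M L s t| <= 1.
Proof.
rewrite ger0_norm ?train_bump_ge0//.
exact: (train_range bump M L s bump0 s0 sL (fun y => y <= 1) t ler01 bump_le1).
Qed.

Lemma train_bump'_le M t : `|train bump' M L s t / s| <= 8 / s.
Proof.
rewrite normrM normfV (gtr0_norm s0) ler_wpM2r ?invr_ge0 ?(ltW s0)//.
apply: (train_range bump' M L s bump'0 s0 sL (fun y => `|y| <= 8) t _ bump'_le).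
by rewrite normr0.
Qed.

Lemma packet_ge0 x : 0 <= u x.
Proof.
by rewrite mulr_ge0 ?(ltW A0)// prodr_ge0// => i _; exact: train_bump_ge0.
Qed.

Lemma packet_le x : u x <= A.
Proof.
rewrite -[leLHS]ger0_norm ?packet_ge0//.
apply: le_trans (tensor_le _ (fun=> 1) _ _ (ltW A0) _) _ => [i|].
  exact: train_bump_le1.
by rewrite big1 ?mulr1//.
Qed.

(** In the middle of a slot each of the d factors is at least e^(-4). *)
Lemma packet_ge x : packet_box N L (s / 2) x -> A * expR (-4) ^+ d <= u x.
Proof.
move=> xb; apply: tensor_ge => [||i]; [exact: ltW|exact: expR_ge0|].
have [k kN xk] := xb i.
rewrite (train_in _ _ _ _ bump0 s0 sL _ k)//.
  apply: expR_le_bump; rewrite normrM normfV (gtr0_norm s0) ler_pdivrMr//.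
  by rewrite [leRHS]mulrC.
by rewrite (le_trans xk)//; move: s0; lra.
Qed.

Lemma not_packet_box (x : 'rV[R]_d) (h : R) : ~ packet_box N L h x ->
  exists i, ~ slots (pulses N i) L h (x ord0 i).
Proof. by move=> /existsNP. Qed.

Lemma packet_out x : ~ packet_box N L s x -> u x = 0.
Proof.
by move=> /not_packet_box[i xi]; apply: (tensor_supp _ _ _ i); exact: train_out.
Qed.

Lemma partial_packet i x : partial i u x =
  tensor A (fun j => if j == i then (fun t => train bump' (pulses N i) L s t / s)
                     else train bump (pulses N j) L s) x.
Proof.
by case: (is_derive_tensor A (fun j => train bump (pulses N j) L s) i
  (fun t => train bump' (pulses N i) L s t / s) x (is_derive_train _ _ _ _)).
Qed.

Lemma partial_packet_le i x : `|partial i u x| <= A * (8 / s).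
Proof.
rewrite partial_packet.
rewrite (le_trans (tensor_le A (fun j => if j == i then 8 / s else 1) _ _ (ltW A0) _))//.
  by move=> j; case: eqP => _; [exact: train_bump'_le|exact: train_bump_le1].
by rewrite (bigD1 i)//= eqxx big1 ?mulr1// => j /negPf ->.
Qed.

Lemma partial_packet_out i x : ~ packet_box N L s x -> partial i u x = 0.
Proof.
move=> /not_packet_box[j xj]; rewrite partial_packet; apply: (tensor_supp _ _ _ j).
case: eqP => [ji|_]; last exact: train_out.
by subst j; rewrite (train_out bump')// mul0r.
Qed.

Lemma enorm_gradient_packet_le x : enorm (gradient u x) <= d%:R * (A * (8 / s)).
Proof. by apply: enorm_le => i; rewrite mxE partial_packet_le. Qed.

Lemma enorm_gradient_packet_out x : ~ packet_box N L s x -> enorm (gradient u x) = 0.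
Proof.
move=> xb; rewrite /enorm big1 ?sqrtr0// => i _.
by rewrite mxE partial_packet_out// expr0n.
Qed.

Lemma packet_Cc_infty : is_Cc_infty u.
Proof.
split=> [k|]; first by apply: is_Ck_tensor => i; exact: flat_algebra_train.
pose M := N%:R * L + L.
have L0 : 0 < L by apply: lt_trans sL; rewrite mulr_gt0.
have cK : compact [set x : 'rV[R]_d | forall i, [set` `[- M, M]] (x ord0 i)].
  by apply: (@rV_compact _ d (fun=> [set` `[- M, M]])) => i; exact: segment_compact.
apply: (subclosed_compact _ cK); first exact: closed_closure.
rewrite closureE; apply: smallest_sub.
  by apply: compact_closed cK; exact: norm_hausdorff.
move=> x ux i; have [k kN xk] : slots (pulses N i) L s (x ord0 i).
  by apply: contrapT => xi; move/eqP: ux; apply; apply: packet_out => /(_ i).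
have k0 : 0 <= k%:R * L by rewrite mulr_ge0// ltW.
have kNL : k%:R * L <= N%:R * L.
  rewrite ler_wpM2r ?(ltW L0)// ler_nat.
  move: kN; rewrite /pulses; case: ifP => _; first exact: ltnW.
  by rewrite ltnS leqn0 => /eqP ->.
move: xk s0 sL L0; rewrite /= in_itv /= /M ler_norml; lra.
Qed.

Lemma measurable_packet : measurable_fun [set: 'rV[R]_d] u.
Proof.
apply: measurable_tensor => i; apply: continuous_measurable_fun.
exact/flat_algebra_continuous/flat_algebra_train.
Qed.

(** The train of [bump'] is a multiple of the derivative of a member of the
    algebra, which is continuous. *)
Lemma measurable_train_bump' M : measurable_fun [set: R] (train bump' M L s).
Proof.
have [f' ff' df] := flat_algebra_derive _ (flat_algebra_train M L s).
have -> : train bump' M L s = fun t => f' t * s.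
  apply/funext => t; have [_ <-] := df t; have [_ ->] := is_derive_train M L s t.
  by rewrite divfK ?gt_eqF.
apply: measurable_funM => //.
by apply: continuous_measurable_fun; exact: flat_algebra_continuous.
Qed.

Lemma measurable_enorm_gradient_packet :
  measurable_fun [set: 'rV[R]_d] (fun x => enorm (gradient u x)).
Proof.
apply: measurable_enorm => i.
rewrite (_ : (fun x => _) = tensor A (fun j => if j == i then
    (fun t => train bump' (pulses N i) L s t / s) else train bump (pulses N j) L s)).
  apply: measurable_tensor => j; case: ifP => _.
    by apply: measurable_funM => //; exact: measurable_train_bump'.
  apply: continuous_measurable_fun.
  exact/flat_algebra_continuous/flat_algebra_train.
by apply/funext => x; rewrite mxE partial_packet.
Qed.

Let powR_packet_le x r : 0 <= r -> `|u x| `^ r <= A `^ r.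
Proof.
by move=> r0; apply: ge0_ler_powR; rewrite ?nnegrE ?(ltW A0)// ger0_norm ?packet_ge0// packet_le.
Qed.

Let powR_packet_out x r : 0 < r -> ~ packet_box N L s x -> `|u x| `^ r = 0.
Proof. by move=> r0 xb; rewrite packet_out// normr0 powR0 ?gt_eqF. Qed.

Let measurable_powR_packet r : measurable_fun [set: 'rV[R]_d] (fun x => `|u x| `^ r).
Proof.
apply: (measurableT_comp (measurable_powR r)); apply: measurableT_comp => //.
exact: measurable_packet.
Qed.

Local Open Scope ereal_scope.

Lemma integral_gradient_packet_le (p : R) : (0 < p)%R ->
  \int[lebesgue_rV]_x (enorm (gradient u x) `^ p)%:E <=
  ((d%:R * (A * (8 / s))) `^ p * (N%:R * (2 * s) ^+ d))%:E.
Proof.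
move=> p0; rewrite EFinM -lebesgue_packet_box//.
rewrite -[X in _ * _ X]setTI; apply: integral_le_cst => //.
- apply: (measurableT_comp (measurable_powR p)).
  exact: measurable_enorm_gradient_packet.
- by move=> x; exact: powR_ge0.
- exact: measurable_packet_box.
- exact: powR_ge0.
- move=> x _; apply: ge0_ler_powR; rewrite ?nnegrE ?(ltW p0) ?sqrtr_ge0//.
    by rewrite !mulr_ge0 ?invr_ge0 ?(ltW A0) ?(ltW s0).
  exact: enorm_gradient_packet_le.
- by move=> x _ xb; rewrite enorm_gradient_packet_out// powR0 ?gt_eqF.
Qed.

Lemma integral_packet_le (r : R) : (0 < r)%R ->
  \int[lebesgue_rV]_x (`|u x| `^ r)%:E <= (A `^ r * (N%:R * (2 * s) ^+ d))%:E.
Proof.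
move=> r0; rewrite EFinM -lebesgue_packet_box//.
rewrite -[X in _ * _ X]setTI; apply: integral_le_cst => //.
- exact: measurable_packet_box.
- exact: powR_ge0.
- by move=> x _; apply: powR_packet_le; exact: ltW.
- by move=> x _; exact: powR_packet_out.
Qed.

Lemma integral_packet_ge (r : R) : (0 < r)%R ->
  ((A * expR (-4) ^+ d) `^ r * (N%:R * s ^+ d))%:E <=
  \int[lebesgue_rV]_x (`|u x| `^ r)%:E.
Proof.
move=> r0; have -> : (s ^+ d = (2 * (s / 2)) ^+ d)%R by rewrite [(2 * _)%R]mulrC divfK.
rewrite EFinM -lebesgue_packet_box//; [|move: s0; lra|move: s0 sL; lra].
apply: integral_ge_cst => //.
- exact: measurable_packet_box.
- exact: powR_ge0.
- move=> x xb; apply: ge0_ler_powR; rewrite ?nnegrE ?(ltW r0)//.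
    by rewrite mulr_ge0 ?(ltW A0)// exprn_ge0// expR_ge0.
  by rewrite ger0_norm ?packet_ge0// packet_ge.
Qed.

(** The ball lies in a cube with the same centre, and the intersection of a cube
    with the support box is again a box, so one-dimensional bounds w i on its
    sides are enough. *)
Lemma integral_packet_eball_le (q rho : R) (w : 'I_d -> R) (z : 'rV[R]_d) :
  (0 < q)%R ->
  (forall i, lebesgue_measure ([set` `[z ord0 i - rho, z ord0 i + rho]%R] `&`
     slots (pulses N i) L s) <= (w i)%:E) ->
  \int[lebesgue_rV]_(x in eball rho z) (`|u x| `^ q)%:E <=
  (A `^ q * \prod_i w i)%:E.
Proof.
move=> q0 zw.
pose B i := [set` `[z ord0 i - rho, z ord0 i + rho]%R] `&` slots (pulses N i) L s.
have mB i : measurable (B i : set (measurableTypeR R)).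
  by apply: measurableI; [exact: measurable_itv|exact: measurable_slots].
apply: (@le_trans _ _ ((A `^ q)%:E * lebesgue_rV (eball rho z `&` packet_box N L s))).
  apply: integral_le_cst => //.
  - exact: measurable_eball.
  - exact: measurable_packet_box.
  - exact: powR_ge0.
  - by move=> x _; apply: powR_packet_le; exact: ltW.
  - by move=> x _; exact: powR_packet_out.
rewrite EFinM; apply: lee_pmul => //; first by rewrite lee_fin powR_ge0.
apply: (@le_trans _ _ (lebesgue_rV [set x | forall i, B i (x ord0 i)])).
  apply: le_measure; rewrite ?inE.
  - by apply: measurableI; [exact: measurable_eball|exact: measurable_packet_box].
  - exact: measurable_rV_box.
  - move=> x [xz xb] i; split; last exact: xb.
    have := le_lt_trans (enorm_ge_coord (x - z) i) xz; rewrite !mxE ltr_norml.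
    by rewrite /= in_itv /=; lra.
rewrite lebesgue_rV_box// -prodEFin.
suff /andP[] : 0 <= \prod_i lebesgue_measure (B i) <= \prod_i (w i)%:E by [].
elim/big_rec2: _ => [|i a b _ /andP[b0 ba]]; first by rewrite lee01 lexx.
by rewrite mule_ge0 ?lee_pmul ?measure_ge0 ?(zw i).
Qed.

End packet.

(** * How much of an interval the slots can fill *)

Section interval_slots.
Context {R : realType}.
Variables (M : nat) (L s z rho : R).
Hypotheses (s0 : 0 < s) (sL : 2 * s < L).
Local Notation I := ([set` `[z - rho, z + rho]] : set (measurableTypeR R)).
Local Open Scope ereal_scope.

Let mI : measurable I. Proof. exact: measurable_itv. Qed.
Let mS : measurable (slots M L s : set (measurableTypeR R)).
Proof. exact: measurable_slots. Qed.

Lemma lebesgue_interval (a h : R) : (0 < h)%R ->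
  lebesgue_measure ([set` `[a - h, a + h]%R]) = (2 * h)%:E.
Proof.
move=> h0; rewrite lebesgue_measure_itv /= lte_fin ltrD2l gtrN// -EFinD.
by congr EFin; ring.
Qed.

Lemma slots_interval_le_length : (0 < rho)%R ->
  lebesgue_measure (I `&` slots M L s) <= (2 * rho)%:E.
Proof.
move=> rho0; rewrite -(lebesgue_interval z)//; apply: le_measure; rewrite ?inE//.
exact: measurableI.
Qed.

Lemma slots_interval_le_total : lebesgue_measure (I `&` slots M L s) <=
  (M%:R * (2 * s))%:E.
Proof.
rewrite -(lebesgue_slots M L)//; apply: le_measure; rewrite ?inE//.
exact: measurableI.
Qed.

(** An interval of half-length rho meeting two slots would contain points at
    distance at most s from two centres, so that L <= 2 (s + rho). *)
Lemma slots_interval_le_pulse : (2 * (s + rho) < L)%R ->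
  lebesgue_measure (I `&` slots M L s) <= (2 * s)%:E.
Proof.
move=> srho; have [[t [tI [k kM tk]]]|none] := pselect (exists t, (I `&` slots M L s) t).
  rewrite -(lebesgue_interval (k%:R * L))//.
  apply: le_measure; rewrite ?inE//; first exact: measurableI.
  move=> t' [t'I [j jM t'j]]; have <- : j = k.
    move: t'I tI t'j tk; rewrite /= !in_itv /= => t'I tI t'j tk.
    by apply: (slot_inj L (s + rho) z); rewrite // ler_norml; move: t'j tk; rewrite !ler_norml; lra.
  by move: t'j; rewrite /= in_itv /= ler_norml; lra.
rewrite (_ : _ `&` _ = set0) ?measure0 ?lee_fin; first by move: s0; lra.
by rewrite -subset0 => t It; apply: none; exists t.
Qed.

End interval_slots.

(** * The choice of scales *)

Section scales.
Context {R : realType}.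
Variables (d : nat) (p q q1 : R).

(** Positive exactly when q is below the Sobolev exponent p d / (d - p); it
    governs how many bumps the gradient bound admits, see [capacityE]. *)
Definition gap : R := d%:R * p - (d%:R - p) * q.

Definition width (n : nat) : R := 2 `^ (d%:R * (q - q1) / gap * n%:R).

(** The number of bumps before rounding to an integer. *)
Definition capacity (n : nat) : R := 2 `^ (d%:R * (q - q1) / q * n%:R).

Definition pulse_count (n : nat) : nat := Num.truncn (capacity n).

(** The least distance between centres for which a ball of radius below
    2^n times the width meets at most one bump. *)
Definition spacing (n : nat) : R := 2 * width n * (1 + 2 ^+ n).

(** Absorbs the constants of the gradient bound, 8 d, and of the volume of a
    cube, 2^d. *)
Definition height_factor : R := (8 * d%:R * 2 ^+ d)^-1.

(** The power of the width for which a single bump is critical for the Morrey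
    condition. *)
Definition height (n : nat) : R := height_factor * width n `^ (- (d%:R / q)).

Hypotheses (d2 : (2 <= d)%N) (p1 : 1 < p) (pd : p < d%:R) (q_gt1 : 1 < q).
Hypothesis (q_sub : q < p * d%:R / (d%:R - p)).
Hypotheses (q1_ge1 : 1 <= q1) (q1q : q1 < q).

Let d_gt0 : 0 < d%:R :> R.
Proof. by rewrite ltr0n (leq_trans _ d2). Qed.

Let q_gt0 : 0 < q. Proof. exact: lt_trans q_gt1. Qed.

Lemma gap_gt0 : 0 < gap.
Proof.
move: q_sub; rewrite ltr_pdivlMr ?subr_gt0// => H.
by rewrite [ltLHS]mulrC [ltRHS]mulrC.
Qed.

Lemma width_gt0 n : 0 < width n. Proof. exact: powR_gt0. Qed.

Lemma widthD n a b : width n `^ a * width n `^ b = width n `^ (a + b).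
Proof. by rewrite powRD// (gt_eqF (width_gt0 n)) implybT. Qed.

Lemma width_exp n : width n ^+ d = width n `^ d%:R.
Proof. by rewrite powR_mulrn// ltW// width_gt0. Qed.

(** The width is calibrated so that the number of bumps allowed by the gradient
    bound is also the number that the Morrey condition tolerates at distance
    2^n times the width. *)
Lemma capacityE n : capacity n = width n `^ (gap / q).
Proof.
rewrite /capacity /width -powRrM; congr powR.
have := gap_gt0; move: q_gt0 => q0 g0; field.
by rewrite !gt_eqF.
Qed.

Lemma pulse_count_le n : (pulse_count n)%:R <= capacity n.
Proof. by rewrite truncn_le powR_ge0. Qed.

Lemma pulse_count_ge n : capacity n / 2 <= (pulse_count n)%:R.
Proof.
(* Rounding down loses at most a factor 2 because there is at least one bump. *)
have X1 : 1 <= capacity n.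
  rewrite -(powRr0 2) ler_powR ?ler1n// mulr_ge0// divr_ge0 ?(ltW q_gt0)//.
  by rewrite mulr_ge0 ?(ltW d_gt0)// subr_ge0 ltW.
have N1 : 1 <= (pulse_count n)%:R :> R by rewrite ler1n truncn_gt0.
have /andP[_] := truncn_itv (powR_ge0 2 (d%:R * (q - q1) / q * n%:R)).
by rewrite -/(capacity n) -/(pulse_count n) -natr1; move: N1; lra.
Qed.

Lemma height_factor_gt0 : 0 < height_factor.
Proof. by rewrite invr_gt0 !mulr_gt0. Qed.

Lemma height_factor_le : height_factor <= (2 ^+ d)^-1.
Proof.
rewrite lef_pV2 ?posrE ?mulr_gt0//; rewrite ler_peMl ?exprn_ge0//.
by rewrite -natrM ler1n muln_gt0 (leq_trans _ d2).
Qed.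

Lemma height_gt0 n : 0 < height n.
Proof. by rewrite mulr_gt0 ?height_factor_gt0 ?powR_gt0 ?width_gt0. Qed.

Lemma spacing_gt n : 2 * width n < spacing n.
Proof.
rewrite /spacing ltr_pMr ?mulr_gt0 ?width_gt0//.
by rewrite ltrDl exprn_gt0.
Qed.

Lemma powR_height n r : height n `^ r = height_factor `^ r * width n `^ (- (d%:R / q) * r).
Proof.
have hf := ltW height_factor_gt0.
by rewrite (powRrM (width n)) /height; move: height_factor hf => h h0; rewrite powRM ?powR_ge0.
Qed.

(** The exponents of the width add up to 0, which is the choice of the number of
    bumps; the constant left is (2^(-d))^p 2^d <= 1. *)
Lemma gradient_scale n :
  (d%:R * (height n * (8 / width n))) `^ p *
    ((pulse_count n)%:R * (2 * width n) ^+ d) <= 1.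
Proof.
have w0 := width_gt0 n; have p0 : 0 < p by exact: lt_trans p1.
have -> : d%:R * (height n * (8 / width n)) =
    (2 ^+ d)^-1 * width n `^ (- (d%:R / q) - 1).
  rewrite /height /height_factor -(widthD n (- (d%:R / q)) (-1)).
  rewrite powR_inv1 ?(ltW w0)//.
  have t0 : 2 ^+ d != 0 :> R by rewrite expf_neq0.
  by move: d_gt0 => d0; field; rewrite t0 !gt_eqF.
rewrite powRM ?powR_ge0 ?invr_ge0 ?exprn_ge0// -powRrM exprMn width_exp.
have h2 : 0 < (2 ^- d : R) <= 1.
  by rewrite invr_gt0 exprn_gt0//= invf_le1 ?exprn_gt0// exprn_ege1// ler1n.
apply: (@le_trans _ _ (((2 ^+ d)^-1 * width n `^ ((- (d%:R / q) - 1) * p)) *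
    (capacity n * (2 ^+ d * width n `^ d%:R)))).
  rewrite ler_pM ?mulr_ge0 ?powR_ge0 ?exprn_ge0//.
    by rewrite ler_wpM2r ?powR_ge0// ge1r_powR// ltW.
  by rewrite ler_wpM2r ?pulse_count_le// mulr_ge0 ?exprn_ge0 ?powR_ge0.
rewrite capacityE.
rewrite [leLHS](_ : _ = width n `^ ((- (d%:R / q) - 1) * p) * width n `^ (gap / q) *
    width n `^ d%:R); last first.
  have t0 : 2 ^+ d != 0 :> R by rewrite expf_neq0.
  by set t := 2 ^+ d in t0 *; field.
rewrite !widthD (_ : _ + _ = 0) ?powRr0//.
by rewrite /gap; move: q_gt0 => q0; field; rewrite gt_eqF.
Qed.

(** The exponent per step n of the integral of |u|^r. *)
Definition growth (r : R) : R :=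
  d%:R ^+ 2 * (q - q1) / (q * gap) * (p * (1 + q / d%:R) - r).

Lemma powR_height_mass n r : width n `^ (- (d%:R / q) * r) * capacity n * width n ^+ d =
  2 `^ (growth r * n%:R).
Proof.
rewrite capacityE width_exp !widthD /width -powRrM; congr powR.
rewrite /growth /gap; have := gap_gt0; rewrite /gap; move: q_gt0 d_gt0 => q0 d0 g0.
by field; rewrite !gt_eqF.
Qed.

Lemma height_factor_powR_le : height_factor `^ q1 * 2 ^+ d <= 1.
Proof.
have t0 : 0 < 2 ^+ d :> R by rewrite exprn_gt0.
have t1 : (2 ^+ d)^-1 <= 1 :> R by rewrite invf_le1// exprn_ege1// ler1n.
rewrite -ler_pdivlMr// div1r (le_trans _ height_factor_le)//.
by rewrite ge1r_powR// height_factor_gt0 (le_trans height_factor_le).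
Qed.

(** For balls smaller than a bump the quotient increases with the radius, with
    the positive exponent d q1 / q, and it is critical at the width itself. *)
Lemma morrey_small n (rho : R) : 0 < rho -> rho <= width n ->
  rho `^ (d%:R * (q1 - q) / q) * (height n `^ q1 * (2 * rho) ^+ d) <= 1.
Proof.
move=> rho0 rhow; have w0 := width_gt0 n.
have e0 : 0 <= d%:R * q1 / q.
  by rewrite divr_ge0 ?(ltW q_gt0)// mulr_ge0// (le_trans ler01).
rewrite powR_height exprMn -[rho ^+ d]powR_mulrn ?(ltW rho0)//.
rewrite [leLHS](_ : _ = height_factor `^ q1 * 2 ^+ d *
    (rho `^ (d%:R * (q1 - q) / q) * rho `^ d%:R * width n `^ (- (d%:R / q) * q1))); last first.
  by move: (height_factor `^ q1) (2 ^+ d) => a b; ring.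
rewrite mulr_ile1 ?height_factor_powR_le ?mulr_ge0 ?powR_ge0 ?exprn_ge0//.
rewrite -powRD ?(gt_eqF rho0) ?implybT//.
have -> : d%:R * (q1 - q) / q + d%:R = d%:R * q1 / q.
  by move: q_gt0 => q0; field; rewrite gt_eqF.
have -> : - (d%:R / q) * q1 = - (d%:R * q1 / q) by ring.
by rewrite powRN ler_pdivrMr ?powR_gt0// mul1r ge0_ler_powR// nnegrE ltW.
Qed.

(** M is the number of bumps that the ball can meet and T a lower bound for the
    radius in units of the width.  The prefactor decays like T^(-d (q - q1) / q),
    which absorbs M.  It is used with T = M = 1, and with T = 2^n and all the
    bumps. *)
Lemma morrey_large n (rho T M : R) : 0 < rho -> 0 < T -> 0 <= M ->
  width n * T <= rho -> M <= T `^ (d%:R * (q - q1) / q) ->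
  rho `^ (d%:R * (q1 - q) / q) *
    (height n `^ q1 * (M * (2 * width n) ^+ d)) <= 1.
Proof.
move=> rho0 T0 M0 wTrho MT; have w0 := width_gt0 n.
pose e := d%:R * (q - q1) / q.
have e0 : 0 <= e.
  by rewrite divr_ge0 ?(ltW q_gt0)// mulr_ge0// subr_ge0 ltW.
have -> : d%:R * (q1 - q) / q = - e by rewrite /e; ring.
apply: (@le_trans _ _ ((width n * T) `^ (- e) *
    (height n `^ q1 * (M * (2 * width n) ^+ d)))).
  rewrite ler_wpM2r ?mulr_ge0 ?powR_ge0 ?exprn_ge0 ?mulr_ge0 ?(ltW w0)//.
  rewrite !powRN lef_pV2 ?posrE ?powR_gt0 ?mulr_gt0//.
  by rewrite ge0_ler_powR// nnegrE ?mulr_ge0 ?(ltW w0) ?(ltW T0) ?(ltW rho0).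
rewrite powR_height exprMn width_exp powRM ?(ltW w0) ?(ltW T0)//.
rewrite [leLHS](_ : _ = height_factor `^ q1 * 2 ^+ d * (T `^ (- e) * M) *
    (width n `^ (- e) * width n `^ (- (d%:R / q) * q1) * width n `^ d%:R)); last first.
  by move: (height_factor `^ q1) (2 ^+ d) => a b; ring.
rewrite !widthD (_ : - e + _ + _ = 0); last first.
  by rewrite /e; move: q_gt0 => q0; field; rewrite gt_eqF.
rewrite powRr0 mulr1 mulr_ile1 ?height_factor_powR_le ?mulr_ge0 ?powR_ge0 ?exprn_ge0//.
by rewrite powRN mulrC ler_pdivrMr ?powR_gt0// mul1r.
Qed.

End scales.

(** * The extremal sequence *)

Section family.
Context {R : realType}.
Variables (d : nat) (p q q1 : R).
Hypotheses (d2 : (2 <= d)%N) (p1 : 1 < p) (pd : p < d%:R) (q_gt1 : 1 < q).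
Hypothesis (q_sub : q < p * d%:R / (d%:R - p)).
Hypotheses (q1_ge1 : 1 <= q1) (q1q : q1 < q).
Local Open Scope ereal_scope.

Definition packet_seq (n : nat) : 'rV[R]_d -> R :=
  packet (height d p q q1 n) (width d p q q1 n) (spacing d p q q1 n)
    (pulse_count d q q1 n).

Let d_gt0 : (0 < d)%N. Proof. exact: leq_trans d2. Qed.
Let h0 n := height_gt0 d p q q1 d2 n.
Let w0 n := width_gt0 d p q q1 n.
Let sL n := spacing_gt d p q q1 n.

Lemma packet_seq_gradient n :
  \int[lebesgue_rV]_x (enorm (gradient (packet_seq n) x) `^ p)%:E <= 1.
Proof.
apply: (le_trans (integral_gradient_packet_le _ _ _ _ d_gt0 (h0 n) (w0 n) (sL n) _ _)).
  exact: lt_trans p1.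
by rewrite lee_fin; exact: gradient_scale.
Qed.

(** The three ranges of radii correspond to the three ways of bounding the sides
    of the box: by the ball, by a single slot, and by all the slots. *)
Lemma packet_seq_morrey n (rho : R) (z : 'rV[R]_d) : (0 < rho)%R ->
  (rho `^ (d%:R * (q1 - q) / q))%:E *
    \int[lebesgue_rV]_(x in eball rho z) (`|packet_seq n x| `^ q1)%:E <= 1.
Proof.
move=> rho0; set w := width d p q q1 n; set L := spacing d p q q1 n.
set N := pulse_count d q q1 n.
have wn0 : (0 < w)%R := w0 n.
have q1_0 : (0 < q1)%R by exact: lt_le_trans q1_ge1.
suff [a ha a1] : exists2 a : R,
    \int[lebesgue_rV]_(x in eball rho z) (`|packet_seq n x| `^ q1)%:E <= a%:E &
    (rho `^ (d%:R * (q1 - q) / q) * a <= 1)%R.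
  by rewrite (le_trans (lee_wpmul2l _ ha)) ?lee_fin ?powR_ge0.
have ball b := integral_packet_eball_le _ _ _ N (h0 n) wn0 (sL n) q1 rho b z q1_0.
have large := morrey_large d p q q1 d2 q_gt1 q1_ge1 q1q n rho.
have [rhow|wrho] := leP rho w.
  eexists; first by apply: (ball (fun=> (2 * rho)%R)) => i; exact: slots_interval_le_length.
  by rewrite prodr_const card_ord; exact: morrey_small.
have [rhoT|Trho] := ltP rho (w * 2 ^+ n)%R.
  eexists.
    apply: (ball (fun=> (2 * w)%R)) => i; apply: slots_interval_le_pulse => //.
    by rewrite /L /spacing -/w; lra.
  rewrite prodr_const card_ord -[((2 * w) ^+ d)%R]mul1r.
  apply: (large 1%R 1%R) => //.
    by rewrite mulr1 ltW.
  by rewrite powR1.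
eexists.
  apply: (ball (fun i => ((pulses N i)%:R * (2 * w))%R)) => i.
  exact: (slots_interval_le_total _ _ _ _ _ wn0 (sL n)).
rewrite big_split /= prod_pulses// prodr_const card_ord.
apply: (large (2 ^+ n)%R _) => //.
rewrite (le_trans (pulse_count_le _ _ _ _))// /capacity.
by rewrite -powR_mulrn// -powRrM mulrC.
Qed.

Lemma packet_seq_Lr_le (r : R) n : (0 < r)%R ->
  \int[lebesgue_rV]_x (`|packet_seq n x| `^ r)%:E <=
  (height_factor d `^ r * 2 ^+ d * 2 `^ (growth d p q q1 r * n%:R))%:E.
Proof.
move=> r0; apply: (le_trans (integral_packet_le _ _ _ _ d_gt0 (h0 n) (w0 n) (sL n) _ r0)).
rewrite lee_fin -powR_height_mass// powR_height// exprMn.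
set a := (height_factor d `^ r)%R; set b := (width d p q q1 n `^ _)%R.
set t := (2 ^+ d)%R; set e := (width d p q q1 n ^+ d)%R.
rewrite [leRHS](_ : _ = a * b * (capacity d q q1 n * (t * e)))%R; last by ring.
by rewrite ler_wpM2l ?mulr_ge0 ?powR_ge0// ler_wpM2r ?pulse_count_le// mulr_ge0 ?exprn_ge0// ltW.
Qed.

Lemma packet_seq_Lr_ge (r : R) n : (0 < r)%R ->
  ((height_factor d * expR (-4) ^+ d) `^ r / 2 * 2 `^ (growth d p q q1 r * n%:R))%:E <=
  \int[lebesgue_rV]_x (`|packet_seq n x| `^ r)%:E.
Proof.
move=> r0; apply: (le_trans _ (integral_packet_ge _ _ _ _ d_gt0 (h0 n) (w0 n) (sL n) _ r0)).
have hf : (0 <= height_factor d :> R)%R by apply: ltW; exact: height_factor_gt0.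
have e0 : (0 <= expR (-4) ^+ d :> R)%R by rewrite exprn_ge0 ?expR_ge0.
rewrite lee_fin -powR_height_mass// (powRM r (ltW (h0 n)) e0) powR_height//.
rewrite (powRM r hf e0).
set a := (height_factor d `^ r)%R; set b := (width d p q q1 n `^ _)%R.
set t := (_ `^ r)%R; set e := (width d p q q1 n ^+ d)%R.
rewrite [leLHS](_ : _ = a * b * t * (capacity d q q1 n / 2 * e))%R; last by ring.
rewrite ler_wpM2l ?mulr_ge0 ?powR_ge0// ler_wpM2r ?exprn_ge0 ?(ltW (w0 n))//.
exact: pulse_count_ge.
Qed.

End family.

(** From e^x >= 1 + x and the archimedean property. *)
Lemma powR2_unbounded {R : realType} (a C : R) : 0 < a ->
  ~ (\forall n \near \oo, 2 `^ (a * n%:R) <= C).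
Proof.
move=> a0 [m _ mC].
have l0 : 0 < a * ln 2 by rewrite mulr_gt0// ln_gt0// ltr1n.
pose n := (m + Num.bound `|C / (a * ln 2)|)%N.
have /= := mC n (leq_addr _ _); apply/negP; rewrite -ltNge.
rewrite /powR gt_eqF// (lt_le_trans _ (expR_ge1Dx _))//.
have Cb : C / (a * ln 2) < n%:R.
  rewrite (le_lt_trans (ler_norm _))// (lt_le_trans (archi_boundP (normr_ge0 _)))//.
  by rewrite ler_nat leq_addl.
move: Cb; rewrite ltr_pdivrMr// mulrC mulrAC => Cb.
by rewrite (lt_trans Cb)// ltrDr.
Qed.

Theorem theorem2p4 (R : realType) (d : nat) (p q : R)
    (hd : (2 <= d)%N)
    (hp1 : 1 < p) (hpd : p < d%:R)
    (hq1 : 1 < q) (hqs : q < p * d%:R / (d%:R - p)) :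
  forall q1 : R, 1 <= q1 -> q1 < q ->
  exists u : nat -> 'rV[R]_d -> R,
    [/\ forall n, is_Cc_infty (u n),
        forall n, (\int[lebesgue_rV]_x
          (enorm (gradient (u n) x) `^ p)%:E <= 1)%E,
        forall n, (ereal_sup
          [set (rho `^ (d%:R * (q1 - q) / q))%:E *
                 \int[lebesgue_rV]_(x in eball rho z) (`|u n x| `^ q1)%:E
             | rho in [set rho : R | (0 < rho)%R] & z in [set: 'rV[R]_d]]
          <= 1)%E,
        forall r : R, 0 < r ->
          sim_near (fun n => \int[lebesgue_rV]_x (`|u n x| `^ r)%:E)%E
            (fun n => (2 `^ (d%:R ^+ 2 * (q - q1)
                             / (q * (d%:R * p - (d%:R - p) * q))
                             * (p * (1 + q / d%:R) - r) * n%:R))%:E) &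
        forall r : R, 0 < r ->
          ((exists2 C : R, 0 < C & \forall n \near \oo,
              (\int[lebesgue_rV]_x (`|u n x| `^ r)%:E <= C%:E)%E) <->
           p * (q / d%:R + 1) <= r)].
Proof.
move=> q1 q1_ge1 q1q; exists (packet_seq d p q q1).
have d_gt0 : (0 < d)%N by exact: leq_trans hd.
have g0 : 0 < gap d p q by exact: gap_gt0.
have q0 : 0 < q by exact: lt_trans hq1.
have dR0 : 0 < d%:R :> R by rewrite ltr0n.
have hf : 0 < height_factor d :> R by exact: height_factor_gt0.
pose c1 r := (height_factor d * expR (-4) ^+ d) `^ r / 2 : R.
pose c2 r := height_factor d `^ r * 2 ^+ d : R.
have c1_gt0 r : 0 < c1 r.
  by rewrite divr_gt0 ?powR_gt0// mulr_gt0// exprn_gt0// expR_gt0.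
have c2_gt0 r : 0 < c2 r by rewrite mulr_gt0 ?powR_gt0// exprn_gt0.
have lo r n : 0 < r -> ((c1 r * 2 `^ (growth d p q q1 r * n%:R))%:E <=
    \int[lebesgue_rV]_x (`|packet_seq d p q q1 n x| `^ r)%:E)%E.
  exact: packet_seq_Lr_ge.
have up r n : 0 < r -> (\int[lebesgue_rV]_x (`|packet_seq d p q q1 n x| `^ r)%:E <=
    (c2 r * 2 `^ (growth d p q q1 r * n%:R))%:E)%E.
  exact: packet_seq_Lr_le.
have growth_le0 r : (growth d p q q1 r <= 0) = (p * (q / d%:R + 1) <= r).
  rewrite /growth pmulr_rle0 ?subr_le0 1?[q / _ + 1]addrC//.
  by rewrite divr_gt0// mulr_gt0 ?exprn_gt0// subr_gt0.
split=> [n|n|n|r r0|r r0].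
- by apply: packet_Cc_infty; [exact: width_gt0|exact: spacing_gt].
- exact: packet_seq_gradient.
- apply: ge_ereal_sup => _ [rho rho0 [z _ <-]].
  exact: packet_seq_morrey.
- exists (c2 r)^-1, (c1 r)^-1; split; rewrite ?invr_gt0//.
  apply: nearW => n; split.
    rewrite (le_trans (lee_wpmul2l _ (up r n r0)))// ?lee_fin ?invr_ge0 ?(ltW (c2_gt0 r))//.
    by rewrite mulKf ?gt_eqF.
  rewrite (le_trans _ (lee_wpmul2l _ (lo r n r0)))// ?lee_fin ?invr_ge0 ?(ltW (c1_gt0 r))//.
  by rewrite mulKf ?gt_eqF.
- rewrite -growth_le0; split=> [[C C0 bC]|gr].
    rewrite leNgt; apply/negP => gr.
    apply: (powR2_unbounded _ (C / c1 r) gr); apply: filterS bC => n nC.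
    by rewrite ler_pdivlMr// mulrC -lee_fin (le_trans (lo r n r0)).
  exists (c2 r) => //; apply: nearW => n; rewrite (le_trans (up r n r0))// lee_fin.
  rewrite ler_piMr ?(ltW (c2_gt0 r))// -[leRHS](powRr0 2) ler_powR ?ler1n//.
  by rewrite mulr_le0_ge0.
Qed.
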